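(* Let $n$ be an odd positive integer, $v\in\mathbb{C}^\times$, $z_1,z_2\in\mathbb{C}^{\times}$, and let $g:\mathbb{Z}\to\mathbb{C}$ be periodic modulo $n$ with $g(0)=-v$ and $g(a)g(n-a)=v$ for all $a\in\mathbb{Z}$ with $n\nmid a$. Let $X,Y\in\{\Delta,\Gamma\}$, and let $T^{X}_{z_1}$, $T^{Y}_{z_2}$, $R^{XY}_{z_1,z_2}$ be the Boltzmann weights defined in the context. Then for every choice of decorated spins $E_1,E_2,E_4,E_5$ and every choice of spins $\varepsilon_3,\varepsilon_6\in\{+,-\}$ one has the Yang--Baxter equation $$\sum_{A_1,A_2,\alpha_3} R^{XY}_{z_1,z_2}(E_1,E_2\to A_1,A_2)\;T^{X}_{z_1}(A_1,\varepsilon_3\to E_4,\alpha_3)\;T^{Y}_{z_2}(A_2,\alpha_3\to E_5,\varepsilon_6)$$ $$=\sum_{O_1,O_2,\omega_3} T^{Y}_{z_2}(E_2,\varepsilon_3\to O_2,\omega_3)\;T^{X}_{z_1}(E_1,\omega_3\to O_1,\varepsilon_6)\;R^{XY}_{z_1,z_2}(O_1,O_2\to E_4,E_5),$$ where the sums run over all decorated spins $A_1,A_2$ (resp. $O_1,O_2$) and all spins $\alpha_3$ (resp. $\omega_3$).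
   Context: A decorated spin is a pair $(\varepsilon,a)$, written $\varepsilon a$, with $\varepsilon\in\{+,-\}$ and $a\in\mathbb{Z}/n\mathbb{Z}$ (the decoration). Let $\delta(a)=1$ if $n\mid a$ and $\delta(a)=0$ otherwise, and $h(a)=(1-v)\delta(a)$. **Vertex weights.** $T^{X}_z(L,t\to Q,b)$ is the weight of a vertex whose left edge has decorated spin $L$, right edge decorated spin $Q$, top edge spin $t$, bottom edge spin $b$. All weights not listed are $0$. For all $a\in\mathbb{Z}/n\mathbb{Z}$: Type $\Delta$: $T^\Delta_z(+a,+\to +a,+)=1$; $T^\Delta_z(-a,-\to -(a{+}1),-)=g(a)z$; $T^\Delta_z(+a,-\to +a,-)=1$; $T^\Delta_z(-a,+\to -(a{+}1),+)=z$; $T^\Delta_z(-a,+\to +a,-)=h(a)z$; $T^\Delta_z(+a,-\to -(a{+}1),+)=\delta(a)$. Type $\Gamma$: $T^\Gamma_z(+(a{+}1),+\to +a,+)=1$; $T^\Gamma_z(-a,-\to -a,-)=z$; $T^\Gamma_z(+(a{+}1),-\to +a,-)=g(a)$; $T^\Gamma_z(-a,+\to -a,+)=z$; $T^\Gamma_z(-a,+\to +a,-)=h(a)z$; $T^\Gamma_z(+(a{+}1),-\to -a,+)=\delta(a)$. **R-weights.** $R^{XY}_{z_1,z_2}(\alpha,\beta\to\gamma,\eta)$ is the weight of a crossing vertex with decorated spins $\alpha$ at bottom left, $\beta$ at top left, $\gamma$ at top right, $\eta$ at bottom right; the strand $\alpha\to\gamma$ has type $X$ and parameter $z_1$, the strand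 $\beta\to\eta$ has type $Y$ and parameter $z_2$. All weights not listed are $0$ (in particular $R=0$ unless every $+$ on a $\Delta$ strand and every $-$ on a $\Gamma$ strand has decoration $0$). $\Delta\Delta$: $(+0,+0\to+0,+0)$: $z_1^n-vz_2^n$; $(-a,+0\to-a,+0)$: $z_1^n-z_2^n$; $(+0,-a\to+0,-a)$: $v(z_1^n-z_2^n)$; $(-a,+0\to+0,-a)$: $(1-v)z_1^{n-a+1}z_2^{a-1}$, with $a$ represented in $[1,n]$; $(+0,-a\to-a,+0)$: $(1-v)z_1^{a-1}z_2^{n-a+1}$, with $a$ represented in $[1,n]$; $(-a,-a\to-a,-a)$: $z_2^n-vz_1^n$; for $a\neq b$: $(-a,-b\to-a,-b)$: $g(a-b)(z_1^n-z_2^n)$, and $(-a,-b\to-b,-a)$: $(1-v)z_1^{n-c}z_2^{c}$ with $c\equiv a-b \pmod n$, $c\in[1,n-1]$. $\Gamma\Gamma$: $(-0,-0\to-0,-0)$: $z_1^n-vz_2^n$; $(-0,+a\to-0,+a)$: $z_1^n-z_2^n$; $(+a,-0\to+a,-0)$: $v(z_1^n-z_2^n)$; $(+a,-0\to-0,+a)$: $(1-v)z_1^{n-a}z_2^{a}$, with $a$ in $[1,n]$; $(-0,+a\to+a,-0)$: $(1-v)z_1^{a}z_2^{n-a}$, with $a$ in $[1,n]$; $(+a,+a\to+a,+a)$: $z_2^n-vz_1^n$; for $a\ne b$: $(+a,+b\to+a,+b)$: $g(b-a)(z_1^n-z_2^n)$, and $(+a,+b\to+b,+a)$: $(1-v)z_1^{n-c}z_2^{c}$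 with $c\equiv a-b\pmod n$, $c\in[1,n-1]$. $\Delta\Gamma$: $(+0,+a\to+0,+a)$: $z_2^n-v^nz_1^n$; $(-a,-0\to-a,-0)$: $z_2^n-v^nz_1^n$; $(+0,-0\to+0,-0)$: $z_2^n-v^{n+1}z_1^n$; for $a+b\equiv1\pmod n$ with $a$ represented in $[1,n]$: $(+0,-0\to-a,+b)$: $(1-v)v^{a-1}z_1^{a-1}z_2^{n-a+1}$, and $(-a,+b\to+0,-0)$: $(1-v)v^{n-a}z_1^{n-a+1}z_2^{a-1}$; for $a+b\equiv1$: $(-a,+b\to-a,+b)$: $v^{n-1}z_1^n-z_2^n$; for $a+b\not\equiv1$: $(-a,+b\to-a,+b)$: $(z_2^n-v^nz_1^n)/g(a+b-1)$; for $a+b\equiv c+d\equiv1$, $a\not\equiv c$: $(-a,+b\to-c,+d)$: $(1-v)v^{e-1}z_1^{e}z_2^{n-e}$ with $e\equiv c-a\pmod n$, $e\in[1,n-1]$. $\Gamma\Delta$: $(+a,+0\to+a,+0)$: $z_1^n-vz_2^n$; $(-0,-a\to-0,-a)$: $z_1^n-vz_2^n$; $(-0,+0\to-0,+0)$: $z_1^n-z_2^n$; for $a+b\equiv1\pmod n$ with $a$ represented in $[1,n]$: $(-0,+0\to+a,-b)$: $(1-v)z_1^{a}z_2^{n-a}$, and $(+a,-b\to-0,+0)$: $(1-v)z_1^{n-a}z_2^{a}$; for $a+b\equiv1$: $(+a,-b\to+a,-b)$: $v^2z_2^n-z_1^n$; for $a+b\not\equiv1$: $(+a,-b\to+a,-b)$: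 $g(a+b-1)(z_1^n-vz_2^n)$; for $a+b\equiv c+d\equiv 1$, $a\not\equiv c$, with $e\equiv a-c\pmod n$, $e\in[1,n-1]$, and $a,c$ represented in $[1,n]$: $(+a,-b\to+c,-d)$: $(v-1)z_1^{n-e}z_2^{e}$ if $a>c$, and $v(v-1)z_1^{n-e}z_2^{e}$ if $a<c$. *)

(* Defs.v *)
(* The weights are over a field C, to be taken as R[i] for R : realType. *)
From mathcomp Require Import all_boot all_order all_algebra.
From mathcomp Require Import reals complex.

Set Implicit Arguments.
Unset Strict Implicit.
Unset Printing Implicit Defensive.

Import GRing.Theory.
Local Open Scope ring_scope.

(* Booleans serve as spins because they come with a finType structure. *)
Notation spin := bool (only parsing).
Notation plus := true (only parsing).
Notation minus := false (only parsing).

(* Z/nZ is represented by 'I_n rather than by 'Z_n, because n = 1 is allowed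
   and 'Z_1 has two elements. The class of a + 1 is [ordS a]. *)
Notation dspin n := (spin * 'I_n)%type (only parsing).

Inductive wtype := Delta | Gamma.

Section Weights.
Variables (C : fieldType) (n : nat) (v : C) (g : int -> C).
Implicit Types (a b c d : 'I_n) (z : C).

Definition delta a : C := (n %| a)%:R.
Definition h a : C := (1 - v) * delta a.

(* The weight T^Delta_z(L, t -> Q, b). *)
Definition TDelta z (L : dspin n) (t : spin) (Q : dspin n) (b : spin) : C :=
  match L, t, Q, b with
  | (plus, a),  plus,  (plus, c),  plus  => if c == a then 1 else 0
  | (minus, a), minus, (minus, c), minus => if c == ordS a then g a%:Z * z else 0
  | (plus, a),  minus, (plus, c),  minus => if c == a then 1 else 0
  | (minus, a), plus,  (minus, c), plus  => if c == ordS a then z else 0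
  | (minus, a), plus,  (plus, c),  minus => if c == a then h a * z else 0
  | (plus, a),  minus, (minus, c), plus  => if c == ordS a then delta a else 0
  | _, _, _, _ => 0
  end.

(* The weight T^Gamma_z(L, t -> Q, b). *)
Definition TGamma z (L : dspin n) (t : spin) (Q : dspin n) (b : spin) : C :=
  match L, t, Q, b with
  | (plus, c),  plus,  (plus, a),  plus  => if c == ordS a then 1 else 0
  | (minus, c), minus, (minus, a), minus => if c == a then z else 0
  | (plus, c),  minus, (plus, a),  minus => if c == ordS a then g a%:Z else 0
  | (minus, c), plus,  (minus, a), plus  => if c == a then z else 0
  | (minus, c), plus,  (plus, a),  minus => if c == a then h a * z else 0
  | (plus, c),  minus, (minus, a), plus  => if c == ordS a then delta a else 0
  | _, _, _, _ => 0
  end.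

Definition T (X : wtype) : C -> dspin n -> spin -> dspin n -> spin -> C :=
  match X with Delta => TDelta | Gamma => TGamma end.

Definition is0 a : bool := a == 0%N :> nat.

(* The representative of a in [1, n]. *)
Definition rep1 a : nat := if is0 a then n else a.

(* The representative of a - b in [0, n - 1]; it lies in [1, n - 1] if a != b. *)
Definition subm a b : nat := ((a + (n - b)) %% n)%N.

(* a + b = 1 in Z/nZ. *)
Definition sum1 a b : bool := (a + b == 1 %[mod n])%N.

(* In the following, [RXY z1 z2 A B G E] is the weight
   R^{XY}_{z1,z2}(A, B -> G, E): A bottom left, B top left, G top right,
   E bottom right; the X strand is A -> G, the Y strand is B -> E. *)

Definition RDeltaDelta z1 z2 (A B G E : dspin n) : C :=
  match A, B, G, E with
  | (plus, a), (plus, b), (plus, c), (plus, d) =>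
      if [&& is0 a, is0 b, is0 c & is0 d] then z1 ^+ n - v * z2 ^+ n else 0
  | (minus, a), (plus, b), (minus, c), (plus, d) =>
      if [&& is0 b, is0 d & c == a] then z1 ^+ n - z2 ^+ n else 0
  | (plus, a), (minus, b), (plus, c), (minus, d) =>
      if [&& is0 a, is0 c & d == b] then v * (z1 ^+ n - z2 ^+ n) else 0
  | (minus, a), (plus, b), (plus, c), (minus, d) =>
      if [&& is0 b, is0 c & d == a] then
        (1 - v) * z1 ^+ (n - rep1 a + 1)%N * z2 ^+ (rep1 a - 1)%N
      else 0
  | (plus, a), (minus, b), (minus, c), (plus, d) =>
      if [&& is0 a, is0 d & c == b] then
        (1 - v) * z1 ^+ (rep1 b - 1)%N * z2 ^+ (n - rep1 b + 1)%N
      else 0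
  | (minus, a), (minus, b), (minus, c), (minus, d) =>
      if a == b then
        if (c == a) && (d == a) then z2 ^+ n - v * z1 ^+ n else 0
      else if (c == a) && (d == b) then
        g (a%:Z - b%:Z) * (z1 ^+ n - z2 ^+ n)
      else if (c == b) && (d == a) then
        (1 - v) * z1 ^+ (n - subm a b)%N * z2 ^+ subm a b
      else 0
  | _, _, _, _ => 0
  end.

Definition RGammaGamma z1 z2 (A B G E : dspin n) : C :=
  match A, B, G, E with
  | (minus, a), (minus, b), (minus, c), (minus, d) =>
      if [&& is0 a, is0 b, is0 c & is0 d] then z1 ^+ n - v * z2 ^+ n else 0
  | (minus, a), (plus, b), (minus, c), (plus, d) =>
      if [&& is0 a, is0 c & d == b] then z1 ^+ n - z2 ^+ n else 0
  | (plus, a), (minus, b), (plus, c), (minus, d) =>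
      if [&& is0 b, is0 d & c == a] then v * (z1 ^+ n - z2 ^+ n) else 0
  | (plus, a), (minus, b), (minus, c), (plus, d) =>
      if [&& is0 b, is0 c & d == a] then
        (1 - v) * z1 ^+ (n - rep1 a)%N * z2 ^+ rep1 a
      else 0
  | (minus, a), (plus, b), (plus, c), (minus, d) =>
      if [&& is0 a, is0 d & c == b] then
        (1 - v) * z1 ^+ rep1 b * z2 ^+ (n - rep1 b)%N
      else 0
  | (plus, a), (plus, b), (plus, c), (plus, d) =>
      if a == b then
        if (c == a) && (d == a) then z2 ^+ n - v * z1 ^+ n else 0
      else if (c == a) && (d == b) then
        g (b%:Z - a%:Z) * (z1 ^+ n - z2 ^+ n)
      else if (c == b) && (d == a) then
        (1 - v) * z1 ^+ (n - subm a b)%N * z2 ^+ subm a b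
      else 0
  | _, _, _, _ => 0
  end.

Definition RDeltaGamma z1 z2 (A B G E : dspin n) : C :=
  match A, B, G, E with
  | (plus, a), (plus, b), (plus, c), (plus, d) =>
      if [&& is0 a, is0 c & d == b] then z2 ^+ n - v ^+ n * z1 ^+ n else 0
  | (minus, a), (minus, b), (minus, c), (minus, d) =>
      if [&& is0 b, is0 d & c == a] then z2 ^+ n - v ^+ n * z1 ^+ n else 0
  | (plus, a), (minus, b), (plus, c), (minus, d) =>
      if [&& is0 a, is0 b, is0 c & is0 d] then
        z2 ^+ n - v ^+ (n + 1)%N * z1 ^+ n
      else 0
  | (plus, a), (minus, b), (minus, c), (plus, d) =>
      if [&& is0 a, is0 b & sum1 c d] then
        (1 - v) * v ^+ (rep1 c - 1)%N * z1 ^+ (rep1 c - 1)%N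
          * z2 ^+ (n - rep1 c + 1)%N
      else 0
  | (minus, a), (plus, b), (plus, c), (minus, d) =>
      if [&& is0 c, is0 d & sum1 a b] then
        (1 - v) * v ^+ (n - rep1 a)%N * z1 ^+ (n - rep1 a + 1)%N
          * z2 ^+ (rep1 a - 1)%N
      else 0
  | (minus, a), (plus, b), (minus, c), (plus, d) =>
      if (c == a) && (d == b) then
        if sum1 a b then v ^+ (n - 1)%N * z1 ^+ n - z2 ^+ n
        else (z2 ^+ n - v ^+ n * z1 ^+ n) / g (a%:Z + b%:Z - 1)
      else if [&& sum1 a b, sum1 c d & a != c] then
        (1 - v) * v ^+ (subm c a - 1)%N * z1 ^+ subm c a
          * z2 ^+ (n - subm c a)%N
      else 0
  | _, _, _, _ => 0
  end.

Definition RGammaDelta z1 z2 (A B G E : dspin n) : C :=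
  match A, B, G, E with
  | (plus, a), (plus, b), (plus, c), (plus, d) =>
      if [&& is0 b, is0 d & c == a] then z1 ^+ n - v * z2 ^+ n else 0
  | (minus, a), (minus, b), (minus, c), (minus, d) =>
      if [&& is0 a, is0 c & d == b] then z1 ^+ n - v * z2 ^+ n else 0
  | (minus, a), (plus, b), (minus, c), (plus, d) =>
      if [&& is0 a, is0 b, is0 c & is0 d] then z1 ^+ n - z2 ^+ n else 0
  | (minus, a), (plus, b), (plus, c), (minus, d) =>
      if [&& is0 a, is0 b & sum1 c d] then
        (1 - v) * z1 ^+ rep1 c * z2 ^+ (n - rep1 c)%N
      else 0
  | (plus, a), (minus, b), (minus, c), (plus, d) =>
      if [&& is0 c, is0 d & sum1 a b] then
        (1 - v) * z1 ^+ (n - rep1 a)%N * z2 ^+ rep1 a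
      else 0
  | (plus, a), (minus, b), (plus, c), (minus, d) =>
      if (c == a) && (d == b) then
        if sum1 a b then v ^+ 2 * z2 ^+ n - z1 ^+ n
        else g (a%:Z + b%:Z - 1) * (z1 ^+ n - v * z2 ^+ n)
      else if [&& sum1 a b, sum1 c d & a != c] then
        (if (rep1 c < rep1 a)%N then v - 1 else v * (v - 1))
          * z1 ^+ (n - subm a c)%N * z2 ^+ subm a c
      else 0
  | _, _, _, _ => 0
  end.

Definition Rw (X Y : wtype)
    : C -> C -> dspin n -> dspin n -> dspin n -> dspin n -> C :=
  match X, Y with
  | Delta, Delta => RDeltaDelta
  | Gamma, Gamma => RGammaGamma
  | Delta, Gamma => RDeltaGamma
  | Gamma, Delta => RGammaDelta
  end.

End Weights.

(* Main.v *)
(* Shift the decoration of each horizontal edge by one where needed (the + on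
   the left of a Gamma vertex, the - on the right of a Delta vertex). In these
   coordinates a T-vertex leaves the decoration unchanged, so both sides of the
   equation become sums over spins only, with at most two nonzero terms each.
   What is left is a finite case analysis, according to the coincidences among
   the four outer decorations and 0; each case is an identity of rational
   functions, using g(a) g(-a) = v. *)
Require Import Defs.
From mathcomp Require Import all_boot all_order all_algebra.
From mathcomp Require Import reals complex.
From mathcomp Require Import zify ring.
Import GRing.Theory.
Local Open Scope ring_scope.
Local Open Scope complex_scope.

Set Implicit Arguments.
Unset Strict Implicit.
Unset Printing Implicit Defensive.

(** * Decorations *)

Section Decorations.
Variable n : nat.
Implicit Types a b : 'I_n.

Lemma eq_ordS a b : (ordS a == ordS b) = (a == b).
Proof. exact: inj_eq (can_inj (@ordSK n)) _ _. Qed.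

(** The wrap-around at a = n - 1 is absorbed, since the class 0 has representative n. Shifted
    exponents thus need no case distinction. *)
Lemma rep1_ordS a : rep1 (ordS a) = a.+1.
Proof.
rewrite /rep1 /is0 /=; have := ltn_ord a; rewrite leq_eqVlt => /orP[/eqP->|an].
  by rewrite modnn.
by rewrite modn_small.
Qed.

Lemma submE a b : subm a b = (if b <= a then a - b else n + a - b)%N.
Proof.
rewrite /subm; have := ltn_ord a; have := ltn_ord b; case: (leqP b a) => ab bn an.
  by rewrite addnBA 1?ltnW // addnC -addnBA // modnDl modn_small //; lia.
by rewrite modn_small; lia.
Qed.

Lemma subm_ordS a b : subm (ordS a) (ordS b) = subm a b.
Proof.
rewrite /subm /= modnDml; have bn := ltn_ord b.
(* If b = n - 1, then [ordS b] is 0 and subtracting it from n leaves a full period. *)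
have [bn'|bn'] := eqVneq b.+1 n.
  by rewrite bn' modnn subn0 modnDr; congr (_ %% _)%N; lia.
by rewrite (@modn_small b.+1); last lia; congr (_ %% _)%N; lia.
Qed.

Lemma subm_leq a b : (subm a b <= n)%N.
Proof.
by rewrite submE; case: (leqP b a); have := ltn_ord a; have := ltn_ord b; lia.
Qed.

Lemma sum1C a b : sum1 a b = sum1 b a.
Proof. by rewrite /sum1 addnC. Qed.

Lemma ordS_mod a : ((ordS a)%:Z == a%:Z + 1 %[mod n%:Z])%Z.
Proof. by rewrite /= -modz_nat modz_mod /= -addn1 PoszD. Qed.

End Decorations.

(** * Decorations as the additive group Z/nZ, for n = m.+1 *)

Section NonemptyDecorations.
Variable m : nat.
Implicit Types a b : 'I_m.+1.

Lemma is0E a : is0 a = (a == ord0). Proof. by []. Qed.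

Lemma rep1E a : rep1 a = if a == ord0 then m.+1 else a. Proof. by []. Qed.

Lemma ord_gt0 a : a != ord0 -> (0 < a)%N. Proof. by rewrite lt0n. Qed.

Lemma subm0r a : subm a ord0 = a.
Proof. by rewrite submE /= subn0. Qed.

Lemma sub0m a : a != ord0 -> subm ord0 a = (m.+1 - a)%N.
Proof.
by move=> a0; rewrite submE leqn0 /= (negPf (a0 : a != 0%N :> nat)) addn0.
Qed.

(* Locked: simpl would otherwise expose the value of [neg a] as a remainder. *)
Definition neg a : 'I_m.+1 := locked (- a).

Lemma negE a : neg a = - a. Proof. by rewrite /neg -lock. Qed.

Lemma neg0 : neg ord0 = ord0. Proof. by rewrite negE; exact: oppr0. Qed.

Lemma eq_neg a b : (neg a == neg b) = (a == b).
Proof. by rewrite !negE eqr_opp. Qed.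

Lemma neg_eq0 a : (neg a == ord0) = (a == ord0).
Proof. by rewrite negE; exact: oppr_eq0. Qed.

Lemma eq0_neg a : (ord0 == neg a) = (ord0 == a).
Proof. by rewrite eq_sym neg_eq0 eq_sym. Qed.

Lemma dvdn_addn_neg a : (m.+1 %| a + neg a)%N.
Proof. by rewrite /dvdn negE /= modnDmr subnKC ?modnn // ltnW. Qed.

(** At a mixed crossing in [shifted_ybe], exactly one of the two decorations tested by [sum1] is
    shifted. So a + b = 1 turns into b = -a, an equality that the case analysis can decide. *)
Lemma sum1_ordSl a b : sum1 (ordS a) b = (b == neg a).
Proof.
rewrite /sum1 /= modnDml addSn -addn1 -[X in _ == X %[mod _]]add0n eqn_modDr.
have /eqP <- := dvdn_addn_neg a.
by rewrite modn_mod eqn_modDl !modn_small.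
Qed.

Lemma sum1_ordSr a b : sum1 a (ordS b) = (b == neg a).
Proof.
by rewrite sum1C sum1_ordSl !negE eq_sym eqr_oppLR.
Qed.

End NonemptyDecorations.

(** Truncated subtraction in exponents is opaque to [field]; quotients of powers are not. *)
Lemma expr_subn (F : fieldType) (z : F) : z != 0 ->
  forall i j, (j <= i)%N -> z ^+ (i - j) = z ^+ i / z ^+ j.
Proof. by move=> z0 i j ji; rewrite expfB_cond // (negPf z0). Qed.

Lemma expr_predn (F : fieldType) (z : F) : z != 0 ->
  forall i, (0 < i)%N -> z ^+ i.-1 = z ^+ i / z.
Proof. by move=> z0 [|i] // _; rewrite exprSr mulfK. Qed.

(** * Vertices with shifted decorations *)

Section ShiftedVertices.
Variables (C : fieldType) (n : nat) (v : C) (g : int -> C).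
Implicit Types (a b c d : 'I_n) (z : C) (X Y : wtype) (s t u w : bool).

Lemma deltaE a : delta C a = if is0 a then 1 else 0.
Proof.
rewrite /delta /is0; case: eqP => [->|/eqP a0]; first by rewrite dvdn0.
by rewrite gtnNdvd ?lt0n.
Qed.

Lemma hE a : h v a = if is0 a then 1 - v else 0.
Proof. by rewrite /h deltaE; case: ifP; rewrite ?mulr1 ?mulr0. Qed.

(** [inc] parametrises the left edges of T-vertices by the shifted decoration, and [out] the right
    edges. *)
Definition inc X s a : dspin n :=
  (s, if X is Gamma then if s then ordS a else a else a).

Definition out X s a : dspin n :=
  (s, if X is Delta then if s then a else ordS a else a).

Definition inc_inv X (A : dspin n) : dspin n :=
  (A.1, if X is Gamma then if A.1 then ord_pred A.2 else A.2 else A.2).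

Definition out_inv X (A : dspin n) : dspin n :=
  (A.1, if X is Delta then if A.1 then A.2 else ord_pred A.2 else A.2).

Lemma incK X : cancel (fun A => inc X A.1 A.2) (inc_inv X).
Proof. by case: X => -[[] a]; rewrite /inc /inc_inv /= ?ordSK. Qed.

Lemma inc_invK X : cancel (inc_inv X) (fun A => inc X A.1 A.2).
Proof. by case: X => -[[] a]; rewrite /inc /inc_inv /= ?ord_predK. Qed.

Lemma outK X : cancel (fun A => out X A.1 A.2) (out_inv X).
Proof. by case: X => -[[] a]; rewrite /out /out_inv /= ?ordSK. Qed.

Lemma out_invK X : cancel (out_inv X) (fun A => out X A.1 A.2).
Proof. by case: X => -[[] a]; rewrite /out /out_inv /= ?ord_predK. Qed.

Definition wt X z a s t u w : C :=
  match s, t, u, w with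
  | plus, plus, plus, plus => 1
  | minus, minus, minus, minus => if X is Delta then g a%:Z * z else z
  | plus, minus, plus, minus => if X is Delta then 1 else g a%:Z
  | minus, plus, minus, plus => z
  | minus, plus, plus, minus => h v a * z
  | plus, minus, minus, plus => delta C a
  | _, _, _, _ => 0
  end.

Lemma T_diag X z a b s t u w :
  T v g X z (inc X s a) t (out X u b) w = if b == a then wt X z a s t u w else 0.
Proof.
by case: X; case: s; case: t; case: u; case: w => //=;
  rewrite ?eq_ordS ?if_same // eq_sym //; case: eqP => // ->.
Qed.

Lemma big_dspin_at (f : dspin n -> dspin n) (F : dspin n -> C) c : bijective f ->
  (forall s a, a != c -> F (f (s, a)) = 0) ->
  \sum_A F A = \sum_(s : bool) F (f (s, c)).
Proof.
move=> f_bij F0; rewrite (reindex f); last exact: onW_bij.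
transitivity (\sum_(s : bool) \sum_a F (f (s, a))).
  by rewrite pair_bigA; apply: eq_bigr => -[].
apply: eq_bigr => s _.
by rewrite (bigD1 c) //= big1 ?addr0 // => a /F0.
Qed.

Lemma big_inc_at X (F : dspin n -> C) c :
  (forall s a, a != c -> F (inc X s a) = 0) ->
  \sum_A F A = \sum_(s : bool) F (inc X s c).
Proof.
by move=> F0; rewrite (big_dspin_at (Bijective (incK X) (inc_invK X)) F0).
Qed.

Lemma big_out_at X (F : dspin n -> C) c :
  (forall s a, a != c -> F (out X s a) = 0) ->
  \sum_A F A = \sum_(s : bool) F (out X s c).
Proof.
by move=> F0; rewrite (big_dspin_at (Bijective (outK X) (out_invK X)) F0).
Qed.

(** The T-vertices force the inner decorations: c and d on the left-hand side, a and b on the right.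
    Hence R meets only [inc] edges on the left and only [out] edges on the right. *)
Definition shifted_ybe X Y z1 z2 := forall s1 s2 s4 s5 e3 e6 a b c d,
  \sum_(l1 : bool) \sum_(l2 : bool) \sum_(w : bool)
     Rw v g X Y z1 z2 (inc X s1 a) (inc Y s2 b) (inc X l1 c) (inc Y l2 d)
       * wt X z1 c l1 e3 s4 w * wt Y z2 d l2 w s5 e6
  = \sum_(l1 : bool) \sum_(l2 : bool) \sum_(w : bool)
     wt Y z2 b s2 e3 l2 w * wt X z1 a s1 w l1 e6
       * Rw v g X Y z1 z2 (out X l1 a) (out Y l2 b) (out X s4 c) (out Y s5 d).

Lemma ybe_of_shifted X Y z1 z2 (E1 E2 E4 E5 : dspin n) (e3 e6 : bool) :
  shifted_ybe X Y z1 z2 ->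
  \sum_(A1 : dspin n) \sum_(A2 : dspin n) \sum_(a3 : bool)
     Rw v g X Y z1 z2 E1 E2 A1 A2
       * T v g X z1 A1 e3 E4 a3
       * T v g Y z2 A2 a3 E5 e6
  = \sum_(O1 : dspin n) \sum_(O2 : dspin n) \sum_(w3 : bool)
     T v g Y z2 E2 e3 O2 w3
       * T v g X z1 E1 w3 O1 e6
       * Rw v g X Y z1 z2 O1 O2 E4 E5.
Proof.
(* Every decorated spin has shifted coordinates of either kind. *)
rewrite -(inc_invK X E1) -(inc_invK Y E2) -(out_invK X E4) -(out_invK Y E5).
case: (inc_inv _ _) => s1 a; case: (inc_inv _ _) => s2 b.
case: (out_inv _ _) => s4 c; case: (out_inv _ _) => s5 d /= ybe.
rewrite (@big_inc_at X _ c); last first.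
  move=> s x /negPf xc; rewrite big1 // => A _; rewrite big1 // => w _.
  by rewrite T_diag eq_sym xc mulr0 mul0r.
rewrite [RHS](@big_out_at X _ a); last first.
  move=> s x /negPf xa; rewrite big1 // => A _; rewrite big1 // => w _.
  by rewrite (T_diag X) xa mulr0 mul0r.
transitivity (\sum_(l1 : bool) \sum_(l2 : bool) \sum_(w : bool)
     Rw v g X Y z1 z2 (inc X s1 a) (inc Y s2 b) (inc X l1 c) (inc Y l2 d)
       * wt X z1 c l1 e3 s4 w * wt Y z2 d l2 w s5 e6).
  apply: eq_bigr => l1 _; rewrite (@big_inc_at Y _ d).
    apply: eq_bigr => l2 _; apply: eq_bigr => w _.
    by rewrite !T_diag !eqxx.
  move=> s x /negPf xd; rewrite big1 // => w _.
  by rewrite (T_diag Y) eq_sym xd mulr0.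
rewrite ybe; apply: eq_bigr => l1 _; rewrite (@big_out_at Y _ b).
  apply: eq_bigr => l2 _; apply: eq_bigr => w _.
  by rewrite !T_diag !eqxx.
move=> s x /negPf xb; rewrite big1 // => w _.
by rewrite (T_diag Y) xb !mul0r.
Qed.

End ShiftedVertices.

(** * Case analysis *)

Section CaseAnalysis.
Variables (C : fieldType) (m : nat) (v : C) (g : int -> C).
Local Notation n := m.+1.
Implicit Types (a b c d : 'I_n) (z : C).
Hypotheses (v_neq0 : v != 0)
    (g_periodic : forall a : int, g (a + n%:Z) = g a)
    (g0 : g 0 = - v)
    (g_mul : forall a : int, ~~ (n%:Z %| a)%Z -> g a * g (n%:Z - a) = v).

(** * Values of g modulo n *)

Lemma g_mod (x y : int) : (x == y %[mod n%:Z])%Z -> g x = g y.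
Proof.
have gM p k : g (p + k%:Z * n%:Z) = g p.
  elim: k p => [|k IH] p; first by rewrite mul0r addr0.
  by rewrite intS mulrDl mul1r addrA IH g_periodic.
have g_modz (t : int) : g t = g (t %% n%:Z)%Z.
  rewrite {1}(divz_eq t n); case: (t %/ n)%Z => k; first by rewrite addrC gM.
  (* [gM] covers natural multiples of n; a negative quotient is cancelled by adding k + 1
     periods. *)
  by rewrite -(gM _ k.+1) NegzE addrAC mulNr addNr add0r.
by move=> /eqP xy; rewrite g_modz xy -g_modz.
Qed.

Lemma g_sub_ordS a b : g ((ordS a)%:Z - (ordS b)%:Z) = g (a%:Z - b%:Z).
Proof.
apply: g_mod; rewrite eqz_mod_dvd.
have := ordS_mod a; have := ordS_mod b; rewrite !eqz_mod_dvd => Hb Ha.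
suff -> : (ordS a)%:Z - (ordS b)%:Z - (a%:Z - b%:Z)
  = ((ordS a)%:Z - (a%:Z + 1)) - ((ordS b)%:Z - (b%:Z + 1)) by apply: rpredB.
ring.
Qed.

Lemma g_ordSl a b : g ((ordS a)%:Z + b%:Z - 1) = g (a%:Z + b%:Z).
Proof.
apply: g_mod; rewrite eqz_mod_dvd.
suff -> : (ordS a)%:Z + b%:Z - 1 - (a%:Z + b%:Z) = (ordS a)%:Z - (a%:Z + 1).
  by rewrite -eqz_mod_dvd ordS_mod.
ring.
Qed.

Lemma g_ordSr a b : g (a%:Z + (ordS b)%:Z - 1) = g (a%:Z + b%:Z).
Proof. by rewrite [a%:Z + _]addrC g_ordSl addrC. Qed.

(** Off the multiples of n, g x is a factor of v. This justifies the divisions by g. *)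
Lemma g_neq0 (x : int) : g x != 0.
Proof.
have [xn|xn] := boolP (n%:Z %| x)%Z.
  by rewrite (@g_mod x 0) ?g0 ?oppr_eq0 // eqz_mod_dvd subr0.
by apply: contraNneq v_neq0 => gx; rewrite -(g_mul xn) gx mul0r.
Qed.

(** Since y = -a modulo n, the product g(a) g(y) is v. Values at -a are thus eliminated and g(a) is
    left as a free unknown for [field]. *)
Lemma g_add0 a (y : int) :
  a != ord0 -> (n%:Z %| a%:Z + y)%Z -> g y = v / g a%:Z.
Proof.
move=> a0 ay; apply: (mulIf (g_neq0 a%:Z)); rewrite divfK ?g_neq0 // mulrC.
have an : ~~ (n%:Z %| a%:Z)%Z by rewrite dvdzE /= gtnNdvd ?ord_gt0.
rewrite -(g_mul an); congr (_ * _); apply: g_mod.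
by rewrite eqz_mod_dvd opprB addrA [y + _]addrC rpredB.
Qed.

Lemma g_0sub a : a != ord0 -> g (0%Z - a%:Z) = v / g a%:Z.
Proof. by move=> a0; apply: g_add0; rewrite // add0r subrr dvdz0. Qed.

Lemma g_neg a : a != ord0 -> g (neg a)%:Z = v / g a%:Z.
Proof. by move=> a0; apply: g_add0; rewrite // dvdzE /= dvdn_addn_neg. Qed.

(* Specialised to C so that autorewrite only has to match syntactically;
   with the general lemmas, unification unfolds the exponentials. *)
Lemma fmulr0 (x : C) : x * 0 = 0. Proof. exact: mulr0. Qed.
Lemma fmul0r (x : C) : 0 * x = 0. Proof. exact: mul0r. Qed.
Lemma fmulr1 (x : C) : x * 1 = x. Proof. exact: mulr1. Qed.
Lemma fmul1r (x : C) : 1 * x = x. Proof. exact: mul1r. Qed.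
Lemma faddr0 (x : C) : x + 0 = x. Proof. exact: addr0. Qed.
Lemma fadd0r (x : C) : 0 + x = x. Proof. exact: add0r. Qed.
Hint Rewrite fmulr0 fmul0r fmulr1 fmul1r faddr0 fadd0r : units.

(** * Splitting into coincidences of decorations, and the resulting identities *)

Ltac simplify :=
  simpl; autorewrite with units;
  try match goal with |- 0 = 0 => reflexivity end.

Ltac normalize_hyps :=
  repeat match goal with
  | H : is_true _ |- _ => rewrite neg0 in H
  | H : is_true _ |- _ => rewrite eq_neg in H
  | H : is_true _ |- _ => rewrite eq0_neg in H
  | H : is_true _ |- _ => rewrite neg_eq0 in H
  end.

Ltac absurd_hyp :=
  normalize_hyps;
  match goal with H : is_true (?x != ?x) |- _ => by rewrite eqxx in H end.

Ltac known_neq x y :=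
  match goal with
  | H : is_true (x != y) |- _ => rewrite (negPf H)
  | H : is_true (y != x) |- _ => rewrite [x == y]eq_sym (negPf H)
  end.

Ltac split_eq x y :=
  let E := fresh "E" in
  case: (eqVneq x y) => [E|?]; [subst; try absurd_hyp|].

(** A test that no hypothesis settles is split; an equality is substituted, and branches that
    contradict an earlier inequality are closed. *)
Ltac decide_eq :=
  match goal with
  | |- context [@eq_op _ ?x ?x] => rewrite eqxx
  | |- context [neg ord0] => rewrite neg0
  | |- context [neg _ == neg _] => rewrite eq_neg
  | |- context [neg _ == ord0] => rewrite neg_eq0
  | |- context [ord0 == neg _] => rewrite eq0_neg
  | |- context [@eq_op _ ?x ?y] => first [known_neq x y | split_eq x y]
  end.

(** Reverting H makes the loop terminate; the bounds 0 < x < n remain for [lia]. *)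
Ltac use_neq0 :=
  repeat match goal with
  | H : is_true (ord0 != ?x) |- _ => rewrite [ord0 == x]eq_sym in H
  end;
  repeat match goal with
  | H : is_true (?x != ord0) |- _ =>
     rewrite ?(sub0m H) ?(g_0sub H) ?(g_neg H);
     have := ord_gt0 H; have := ltn_ord x; revert H
  end; intros.

Ltac field_identity :=
  first [ring | field; rewrite ?expf_neq0 ?g_neq0 ?oner_neq0 ?andbT /=;
                by repeat (apply/andP; split)].

Ltac solve_case :=
  rewrite ?subm_ordS ?subm0r; use_neq0; rewrite ?add0r ?addr0 ?subr0;
  rewrite ?subSS ?subn1 ?subnn ?succnK ?addn1 /= ?subn1 ?addn1 ?g0;
  try solve [field_identity];
  rewrite ?(exprS, expr_subn, expr_predn) ?subm_leq //; try lia;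
  (* These tests come from comparing representatives in the weight of type Gamma Delta. *)
  repeat match goal with
  | |- context [if (?x <= ?y)%N then _ else _] =>
     case: (leqP x y) => ?; try lia
  end;
  field_identity.

Lemma shifted_ybe_holds X Y z1 z2 :
  z1 != 0 -> z2 != 0 -> @shifted_ybe C n v g X Y z1 z2.
Proof.
move=> z1_neq0 z2_neq0 s1 s2 s4 s5 e3 e6 a b c d.
rewrite !big_bool.
(* R stays abstract until the vanishing T-weights have removed most terms. *)
move defR: (Rw v g X Y z1 z2) => R.
(* Four pairs of types, each with 64 outer spin configurations. *)
case: X defR; case: Y => defR;
  case: s1; case: s2; case: s4; case: s5; case: e3; case: e6;
  rewrite /wt; simplify.
(* The decorations that R requires to be 0 are never shifted; the other shifts cancel or are
   absorbed, which leaves tests among a, b, c, d, their negatives and 0. *)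
all: rewrite -{}defR {R} /inc /out /= ?eq_ordS ?rep1_ordS ?subm_ordS
  ?sum1_ordSl ?sum1_ordSr ?g_ordSl ?g_ordSr ?g_sub_ordS ?hE ?deltaE ?rep1E ?is0E.
all: repeat (decide_eq; simplify).
all: solve_case.
Qed.

End CaseAnalysis.

Theorem theorem2 (R : realType) (n : nat) (n_odd : odd n)
    (v z1 z2 : R[i]) (v_neq0 : v != 0) (z1_neq0 : z1 != 0) (z2_neq0 : z2 != 0)
    (g : int -> R[i])
    (g_periodic : forall a : int, g (a + n%:Z) = g a)
    (g0 : g 0 = - v)
    (g_mul : forall a : int, ~~ (n%:Z %| a)%Z -> g a * g (n%:Z - a) = v)
    (X Y : wtype) (E1 E2 E4 E5 : dspin n) (e3 e6 : spin) :
  \sum_(A1 : dspin n) \sum_(A2 : dspin n) \sum_(a3 : spin)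
     Rw v g X Y z1 z2 E1 E2 A1 A2
       * T v g X z1 A1 e3 E4 a3
       * T v g Y z2 A2 a3 E5 e6
  = \sum_(O1 : dspin n) \sum_(O2 : dspin n) \sum_(w3 : spin)
     T v g Y z2 E2 e3 O2 w3
       * T v g X z1 E1 w3 O1 e6
       * Rw v g X Y z1 z2 O1 O2 E4 E5.

Proof.
(* Oddness excludes n = 0. *)
case: n n_odd g_periodic g_mul E1 E2 E4 E5 => // m _ g_periodic g_mul E1 E2 E4 E5.
exact/ybe_of_shifted/shifted_ybe_holds.
Qed.
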